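(* Let $\delta>0$ be a fixed constant. Any online bin covering algorithm with advice that achieves a competitive ratio of $15/16+\delta$ on input sequences of length $n$ must receive $\Omega(n)$ bits of advice.
   Context: Bin covering: items with sizes in $(0,1]$ arrive online and each must be irrevocably placed into a bin; a bin is covered if the total size of its items is at least $1$; the goal is to maximize the number of covered bins. In the advice-on-tape model, an oracle with unlimited power writes an advice string beforehand; the decision for the $i$-th item may depend on the advice and the sizes of the first $i$ items. $A(\sigma)$ is the number of bins covered by $A$ and $\mathrm{OPT}(\sigma)$ the maximum possible number. $A$ is $c$-competitive with advice complexity $s(n)$ if there is a constant $b$ such that for all $n$ and all sequences $\sigma$ of length at most $n$ there is advice $\Phi$ with $A(\sigma)\ge c\cdot\mathrm{OPT}(\sigma)-b$ and at most $s(n)$ bits of $\Phi$ read. *)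

(* Defs.v *)
From HB Require Import structures.
From mathcomp Require Import all_boot all_order all_algebra.
From mathcomp Require Import reals.

Set Implicit Arguments.
Unset Strict Implicit.
Unset Printing Implicit Defensive.
Import Order.TTheory GRing.Theory Num.Theory.
Local Open Scope ring_scope.

Section BinCovering.
Variable R : realType.
Implicit Types sigma : seq R.

Definition valid_input sigma : bool := all (fun x => 0 < x <= 1) sigma.

Section Packings.
Variables (sigma : seq R) (B : eqType) (p : 'I_(size sigma) -> B).

Definition level (b : B) : R := \sum_(i < size sigma | p i == b) sigma`_i.

(* Unused bins have level 0, so only the bins in the image of p can be covered. *)
Definition covered : nat := count (fun b => 1 <= level b) (undup (codom p)).

End Packings.

(* A packing of m items uses at most m bins, so m bin labels are enough. *)
Definition OPT sigma : nat :=
  \max_(p : {ffun 'I_(size sigma) -> 'I_(size sigma)}) covered p.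

Definition tape := nat -> bool.

(* bin_of Phi tau is the label of the bin receiving the last item of tau when  *)
(* tau is the part of the input revealed so far; labels of bins not used yet   *)
(* stand for opening a new bin. bits_read Phi tau is the number of tape cells  *)
(* read, sequentially from cell 0, from the start until the last item of tau   *)
(* is placed. It is None if the algorithm keeps reading forever, in which case *)
(* bin_of Phi tau is a dummy value.                                            *)
Record advice_algorithm := AdviceAlgorithm {
  bin_of : tape -> seq R -> nat;
  bits_read : tape -> seq R -> option nat;
  bits_read_prefix : forall (Phi : tape) (tau : seq R) (k i : nat),
    bits_read Phi tau = Some k ->
    exists2 j, bits_read Phi (take i tau) = Some j & (j <= k)%N;
  bits_read_local : forall (Phi Phi' : tape) (tau : seq R) (k : nat),
    bits_read Phi tau = Some k ->
    (forall j, (j < k)%N -> Phi' j = Phi j) ->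
    bits_read Phi' tau = Some k /\ bin_of Phi' tau = bin_of Phi tau
}.

Definition bins_covered (A : advice_algorithm) (Phi : tape) sigma : nat :=
  covered (fun i : 'I_(size sigma) => bin_of A Phi (take i.+1 sigma)).

Definition competitive_with_advice
    (A : advice_algorithm) (c : R) (s : nat -> nat) : Prop :=
  exists b : R, forall (n : nat) (sigma : seq R),
    valid_input sigma -> (size sigma <= n)%N ->
    exists Phi : tape,
      (bins_covered A Phi sigma)%:R >= c * (OPT sigma)%:R - b /\
      (exists2 k, bits_read A Phi sigma = Some k & (k <= s n)%N).

End BinCovering.

(* Main.v *)
(** Items of the first phase are slightly smaller than 1, and each is large or
    small. A binary search on the scale of the deficits [1 - x] hides the type
    of an item until it is packed, and makes the deficit of every small item
    exceed the sum of the deficits of all large items. The second phase sends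
    the deficits of the large items, so an optimal packing covers one bin per
    large item and one per pair of small items, whereas in an online packing a
    first-phase item alone in its bin leads to a covered bin only if it is
    large. By linear programming duality an online algorithm covers at most
    1, 1/3 or 2/3 bins per item that opens a bin and is large, opens a bin and
    is small, or joins another first-phase item. If the types are fair coin
    flips this is 2/3 on average, while OPT is 3/4 per item; hence a fixed tape
    reaches ratio 14/15 > 8/9 with exponentially small probability, and a union
    bound over the tape prefixes shows that linearly many bits are read. *)

Require Import Defs.
From mathcomp Require Import all_boot all_order all_algebra.
From mathcomp Require Import reals.
From mathcomp Require Import zify lra.
Set Implicit Arguments.
Unset Strict Implicit.
Unset Printing Implicit Defensive.
Import Order.TTheory GRing.Theory Num.Theory.
Local Open Scope ring_scope.

(** * Packings and lower bounds on the optimum *)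

Section Packings.
Variables (R : realType) (B : eqType).
Implicit Types (sigma : seq R) (bs : seq B).

Lemma eq_covered sigma (p p' : 'I_(size sigma) -> B) :
  p =1 p' -> covered p = covered p'.
Proof.
move=> eq_p; rewrite /covered (eq_codom eq_p); apply: eq_count => b.
by rewrite /level (eq_bigl _ _ (fun i => congr1 (eq_op^~ b) (eq_p i))).
Qed.

Lemma covered_ge sigma (p : 'I_(size sigma) -> B) bs :
  uniq bs -> {in bs, forall b, 1 <= level p b} -> (size bs <= covered p)%N.
Proof.
move=> Ubs bs_cov; rewrite /covered -size_filter.
apply: uniq_leq_size => // b b_bs; rewrite mem_filter mem_undup bs_cov //=.
apply: contraLR (bs_cov b b_bs) => b_codom.
rewrite /level big_pred0 ?ler10 // => i.
by apply: contraNF b_codom => /eqP <-; apply: codom_f.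
Qed.

Lemma covered_le_OPT sigma (p : 'I_(size sigma) -> B) :
  (covered p <= OPT sigma)%N.
Proof.
(* A label is renamed to the first item that carries it; [i0] is the default value of [nth]. *)
pose g b (i0 : 'I_(size sigma)) : 'I_(size sigma) :=
  nth i0 (enum 'I_(size sigma)) (index b (codom p)).
have pg i0 i : p (g (p i) i0) = p i.
  rewrite /g -(nth_map _ (p i0)) -?codomE ?nth_index ?codom_f //.
  by have := codom_f p i; rewrite -index_mem size_codom card_ord size_enum_ord.
pose p' := [ffun i => g (p i) i].
have gE i0 i : g (p i) i0 = p' i.
  rewrite /p' ffunE /g; apply: set_nth_default.
  by have := codom_f p i; rewrite -index_mem size_codom card_ord size_enum_ord.
have p'_inj i j : (p' i == p' j) = (p i == p j).
  apply/eqP/eqP => [eq_ij | eq_ij]; last by rewrite -(gE j) eq_ij ffunE.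
  by rewrite -(pg i i) -(pg j j) -/(g _ _) (gE i i) (gE j j) eq_ij.
apply: leq_trans (leq_bigmax p').
rewrite {1}/covered -size_filter; set bs := filter _ _.
have bsP b : b \in bs -> exists2 i, b = p i & 1 <= level p b.
  by rewrite mem_filter mem_undup => /andP[lb /codomP[i bE]]; exists i.
case: (pickP 'I_(size sigma)) => [i0 _ | no_i]; last first.
  by case: bs bsP => // b bs /(_ b); rewrite mem_head => -[|i]//; have := no_i i.
rewrite -(size_map (g^~ i0)) /covered -size_filter.
apply: uniq_leq_size => [|k].
  rewrite map_inj_in_uniq ?filter_uniq ?undup_uniq // => b c.
  move=> /bsP[i -> _] /bsP[j -> _] /(congr1 p).
  by rewrite !pg.
case/mapP=> b /bsP[i -> lb] ->; rewrite gE mem_filter mem_undup codom_f andbT.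
by rewrite /level (eq_bigl _ _ (p'_inj^~ i)).
Qed.

(** An offline packing may list the items in any order: the permutation carries each label back to
    the position of its item. *)
Lemma labelling_le_OPT sigma (z : seq (R * B)) bs :
  perm_eq sigma (unzip1 z) -> uniq bs ->
  {in bs, forall b, 1 <= \sum_(y <- z | y.2 == b) y.1} ->
  (size bs <= OPT sigma)%N.
Proof.
case: bs => [//|b0 bs']; move: (b0 :: bs') => bs.
case/(perm_iotaP 0) => Is; rewrite size_map => permIs sigmaE Ubs bs_cov.
pose z' := map (nth (0, b0) z) Is.
have perm_z : perm_eq z' z.
  rewrite -[X in perm_eq _ X](mkseq_nth (0, b0)); exact: perm_map.
have -> : sigma = unzip1 z'.
  rewrite sigmaE /z' /unzip1 -map_comp; apply/eq_in_map => i.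
  by rewrite (perm_mem permIs) mem_iota => /andP[_ lt_i]; rewrite (nth_map (0, b0)).
pose p (i : 'I_(size (unzip1 z'))) := (nth (0, b0) z' i).2.
apply: leq_trans (covered_le_OPT p); apply: covered_ge => // b b_bs.
suff -> : level p b = \sum_(y <- z | y.2 == b) y.1 by exact: bs_cov.
rewrite -(perm_big _ perm_z) (big_nth (0, b0)) /level.
rewrite -(big_mkord (fun i => (nth (0, b0) z' i).2 == b) (nth 0 (unzip1 z'))).
rewrite size_map big_nat_cond [RHS]big_nat_cond; apply: eq_bigr => i.
by case/andP=> /andP[_ lt_i] _; rewrite (nth_map (0, b0)).
Qed.

End Packings.

(** * The hard inputs and their optimal packings *)

Section HardInstance.
Variables (R : realType) (m : nat).
Implicit Types t : seq bool.

(* Item i bisects the exponent interval (offset, offset + 2 ^ (m - i + 1)); a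
   large item, encoded by true, keeps the lower half. *)
Definition offset t i := (\sum_(j < i | ~~ nth false t j) 2 ^ (m - j))%N.

(** The midpoint of the interval that item [i] bisects. *)
Definition exponent t i := (offset t i + 2 ^ (m - i))%N.

Definition deficit t i : R := m.+2%:R ^- exponent t i.

Definition hard_input t : seq R :=
  mkseq (fun i => 1 - deficit t i) m
    ++ [seq deficit t i | i <- iota 0 m & nth false t i].

Lemma offsetS t i :
  offset t i.+1 =
  (offset t i + if nth false t i then 0 else 2 ^ (m - i))%N.
Proof. by rewrite /offset big_mkcond big_ord_recr -big_mkcond; case: nth. Qed.

(** The size of item [i] depends on the types of earlier items only, so it does not reveal the type
    of [i]. *)
Lemma exponent_take t i k : (i <= k)%N -> exponent (take k t) i = exponent t i.
Proof.
move=> le_ik; congr (_ + _)%N; apply: eq_bigl => j.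
by rewrite nth_take // (leq_trans (ltn_ord j)).
Qed.

Lemma exponent_gt0 t i : (0 < exponent t i)%N.
Proof. by rewrite addn_gt0 expn_gt0 orbT. Qed.

Lemma leq_offset t i j : (i <= j)%N -> (offset t i <= offset t j)%N.
Proof.
by move/subnK=> <-; elim: (j - i)%N => // k IHk; rewrite addSn offsetS; lia.
Qed.

(* The upper end of the search interval never increases. *)
Lemma leq_offset_upper t i j : (i <= j <= m)%N ->
  (offset t j + 2 ^ (m.+1 - j) <= offset t i + 2 ^ (m.+1 - i))%N.
Proof.
case/andP=> /subnK <-; elim: (j - i)%N => // k IHk; rewrite addSn => lt_km.
apply: leq_trans (IHk (ltnW lt_km)); rewrite offsetS subSS subSn ?expnS ?(ltnW lt_km) //.
by case: ifP; lia.
Qed.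

(** The exponent of a small item becomes the lower end of the next interval, that of a large item
    its upper end, and the intervals are nested. *)
Lemma exponent_lt t i j : (i < m)%N -> (j < m)%N ->
  ~~ nth false t i -> nth false t j -> (exponent t i < exponent t j)%N.
Proof.
move=> lt_im lt_jm small_i large_j.
have eS : exponent t i = offset t i.+1 by rewrite offsetS (negPf small_i).
have oS : offset t j.+1 = offset t j by rewrite offsetS large_j addn0.
rewrite /(exponent t j) eS.
have [lt_ij | le_ji] := ltnP i j.
  have := leq_offset t lt_ij; have : (0 < 2 ^ (m - j))%N by rewrite expn_gt0.
  lia.
have le_ji_m : (j < i.+1 <= m)%N by lia.
have := leq_offset_upper t le_ji_m; rewrite !subSS oS.
have : (0 < 2 ^ (m - i))%N by rewrite expn_gt0.
lia.
Qed.

Lemma deficit_gt0 t i : 0 < deficit t i.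
Proof. by rewrite invr_gt0 exprn_gt0 ?ltr0n. Qed.

(** There are at most [m] summands, each at most 1/(m+2) times the bound; hence the base [m.+2] of
    [deficit]. *)
Lemma sum_deficits_lt t e : 
  (forall i, (i < m)%N -> nth false t i -> (e < exponent t i)%N) ->
  \sum_(i <- iota 0 m | nth false t i) deficit t i < m.+2%:R ^- e.
Proof.
move=> lt_e; have e0 : 0 < m.+2%:R ^- e :> R by rewrite invr_gt0 exprn_gt0 ?ltr0n.
have le_d i : i \in iota 0 m -> nth false t i ->
    deficit t i <= m.+2%:R ^- e / m.+2%:R.
  rewrite mem_iota => lt_im large_i; rewrite -invfM -exprSr.
  rewrite lef_pV2 ?posrE ?exprn_gt0 ?ltr0n //.
  by rewrite ler_weXn2l ?ler1n ?lt_e.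
rewrite big_seq_cond; apply: le_lt_trans.
  by apply: ler_sum => i /andP[]; apply: le_d.
rewrite -big_seq_cond big_const_seq iter_addr_0.
apply: (@le_lt_trans _ _ (m.+2%:R ^- e / m.+2%:R *+ m)).
  apply: ler_wpMn2l; first by rewrite ltW // divr_gt0 ?ltr0n.
  by rewrite (leq_trans (count_size _ _)) ?size_iota.
rewrite -mulr_natr -mulrA gtr_pMr // mulrC ltr_pdivrMr ?ltr0n // mul1r ltr_nat.
lia.
Qed.

Lemma sum_deficits_lt_small t i : (i < m)%N -> ~~ nth false t i ->
  \sum_(j <- iota 0 m | nth false t j) deficit t j < deficit t i.
Proof.
by move=> lt_im small_i; apply: sum_deficits_lt => j *; apply: exponent_lt.
Qed.

Lemma sum_deficits_lt1 t :
  \sum_(j <- iota 0 m | nth false t j) deficit t j < 1.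
Proof.
rewrite -invr1 -[X in X^-1](expr0 m.+2%:R).
by apply: sum_deficits_lt => *; apply: exponent_gt0.
Qed.

Lemma deficit_le_half t i : deficit t i <= 2^-1.
Proof.
rewrite lef_pV2 ?posrE ?exprn_gt0 ?ltr0n //.
rewrite (le_trans (_ : 2 <= m.+2%:R)) ?ler_nat //.
by rewrite -[leLHS]expr1 ler_weXn2l ?ler1n ?exponent_gt0.
Qed.

Lemma deficit_lt1 t i : deficit t i < 1.
Proof. by apply: le_lt_trans (deficit_le_half t i) _; rewrite invf_lt1 ?ltr1n. Qed.

Lemma hard_input_valid t : valid_input (hard_input t).
Proof.
rewrite /valid_input all_cat; apply/andP; split; apply/allP => x /mapP[i _ ->].
  by rewrite subr_gt0 deficit_lt1 gerBl ltW ?deficit_gt0.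
by rewrite deficit_gt0 ltW ?deficit_lt1.
Qed.

Lemma size_hard_input t : (size (hard_input t) <= m.*2)%N.
Proof.
rewrite size_cat size_mkseq size_map size_filter -addnn leq_add2l.
by rewrite (leq_trans (count_size _ _)) ?size_iota.
Qed.

Lemma take_hard_input t i : (i <= m)%N ->
  take i (hard_input t) = mkseq (fun j => 1 - deficit t j) i.
Proof.
by move=> le_im; rewrite takel_cat ?size_mkseq // -map_take take_iota (minn_idPl le_im).
Qed.

(* Twice the number of bins per item in the optimal packing. *)
Definition OPT_weight (l : bool) : nat := if l then 2 else 1.

(** The final [.+1] pays for a small item left without a partner. *)
Lemma hard_input_OPT t :
  (\sum_(i < m) OPT_weight (nth false t i) <= (OPT (hard_input t)).*2.+1)%N.
Proof.
pose Ls := [seq i <- iota 0 m | nth false t i].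
pose Ss := [seq i <- iota 0 m | ~~ nth false t i].
(* Bin [(true, i)] gets large item [i] and its deficit, of total size 1; bin [(false, k)] gets the
   small items at positions 2k and 2k+1 of [Ss], each of size at least 1/2. *)
pose z : seq (R * (bool * nat)) :=
  [seq (1 - deficit t i, (true, i)) | i <- Ls]
  ++ [seq (1 - deficit t (nth 0 Ss j), (false, j./2)) | j <- iota 0 (size Ss)]
  ++ [seq (deficit t i, (true, i)) | i <- Ls].
pose bs := [seq (true, i) | i <- Ls] ++ [seq (false, k) | k <- iota 0 (size Ss)./2].
have -> : (\sum_(i < m) OPT_weight (nth false t i) = (size Ls).*2 + size Ss)%N.
  rewrite -(big_mkord xpredT (fun i => OPT_weight (nth false t i))) /index_iota subn0.
  rewrite !size_filter; elim: (iota 0 m) => [|i s IHs]; first by rewrite big_nil.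
  by rewrite big_cons IHs /=; case: nth => /=; lia.
suff : (size bs <= OPT (hard_input t))%N.
  by rewrite size_cat !size_map size_iota; have := odd_double_half (size Ss); lia.
have d1 i : 0 <= 1 - deficit t i.
  by have := deficit_le_half t i; lra.
apply: (@labelling_le_OPT _ _ _ z).
- rewrite /z /unzip1 !map_cat -!map_comp catA perm_cat2r.
  have -> : [seq (fst \o (fun j => (1 - deficit t (nth 0%N Ss j), (false, j./2)))) j
            | j <- iota 0 (size Ss)] = [seq 1 - deficit t i | i <- Ss].
    by rewrite -[in RHS](mkseq_nth 0%N Ss) -map_comp.
  by rewrite -map_cat perm_map // perm_sym perm_filterC.
- rewrite cat_uniq !map_inj_uniq ?filter_uniq ?iota_uniq ?andbT //; try by move=> ? ? [].
  by apply/hasPn => _ /mapP[k _ ->]; apply/mapP => -[].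
move=> b; rewrite mem_cat => /orP[] /mapP[k k_in ->]; rewrite /z !big_cat !big_map /=.
  have addk (F : nat -> R) : \sum_(j <- Ls | (true, j) == (true, k)) F j = F k.
    rewrite (eq_bigl (pred1 k)) => [|j]; last by rewrite xpair_eqE.
    by rewrite -big_filter filter_pred1_uniq ?filter_uniq ?iota_uniq ?big_seq1.
  rewrite !addk; have := @sumr_ge0 R _ (iota 0 (size Ss)) (fun j => (false, j./2) == (true, k))
    (fun j => 1 - deficit t (nth 0%N Ss j)) (fun j _ => d1 _); lra.
move: k_in; rewrite mem_iota /= add0n => lt_k.
rewrite big_pred0 // add0r [X in _ + X]big_pred0 // addr0.
have lt2k : (k.*2.+1 < size Ss)%N by have := odd_double_half (size Ss); lia.
rewrite -(subnKC lt2k) -addn2 !iotaD !big_cat /= !big_cons big_nil add0n.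
rewrite !xpair_eqE doubleK (uphalf_double k : k.*2.+1./2 = k)%N !eqxx /=.
have sum_ge0 s : 0 <= \sum_(j <- s | (false, j./2) == (false, k))
    (1 - deficit t (nth 0%N Ss j)) by apply: sumr_ge0.
have := sum_ge0 (iota 0 k.*2).
have := sum_ge0 (iota (k.*2 + 2) (size Ss - (k.*2 + 2))).
have := deficit_le_half t (nth 0%N Ss k.*2).
have := deficit_le_half t (nth 0%N Ss k.*2.+1); lra.
Qed.

End HardInstance.

(** * Upper bound on the bins covered online *)

Definition opens (B : eqType) (q : nat -> B) i := q i \notin mkseq q i.

(* Three times the dual bound on the number of bins an item helps to cover. *)
Definition cover_weight (o l : bool) : nat := if o then (if l then 3 else 1) else 2.

Section CoveredUpperBound.
Variables (R : realType) (m : nat) (t : seq bool) (B : eqType) (q : nat -> B).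
Let D : R := \sum_(j <- iota 0 m | nth false t j) deficit R m t j.

(** Every bin is generously credited with the whole second phase, of total size [D]. *)
Lemma level_hard_input_le b :
  level (fun i : 'I_(size (hard_input R m t)) => q i) b
    <= \sum_(0 <= i < m | q i == b) (1 - deficit R m t i) + D.
Proof.
rewrite /level -(big_mkord (fun i => q i == b) (nth 0 (hard_input R m t))).
rewrite size_cat size_mkseq (@big_cat_nat _ _ _ m) ?leq_addr //=; apply: lerD.
  rewrite big_nat_cond [leRHS]big_nat_cond le_eqVlt; apply/predU1P; left.
  apply: eq_bigr => i /andP[/andP[_ lt_im] _].
  by rewrite nth_cat size_mkseq lt_im nth_mkseq.
rewrite /D -(big_filter _ (nth false t)) -(big_map (deficit R m t) xpredT id).
set ds := map _ _; rewrite -{1}[m]add0n big_addn addKn [leRHS](big_nth 0) big_mkcond.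
rewrite [leLHS]big_nat_cond [leRHS]big_nat_cond.
apply: ler_sum => i; rewrite andbT => lt_i.
rewrite nth_cat size_mkseq ltnNge leq_addl /= addnK.
case: ifP => // _; have /mapP[j _ ->] : nth 0 ds i \in ds by rewrite mem_nth.
by rewrite ltW ?deficit_gt0.
Qed.

(** Dual feasibility. As [D] is below 1, a covered bin has a first-phase item. A large opener weighs
    3; a small one weighs 1 and needs a companion of weight 2, because its deficit exceeds [D]. *)
Lemma covered_bin_weight b :
  1 <= level (fun i : 'I_(size (hard_input R m t)) => q i) b ->
  (3 <= \sum_(i < m | q i == b) cover_weight (opens q i) (nth false t i))%N.
Proof.
move/le_trans/(_ (level_hard_input_le b)); rewrite big_mkord.
have [i0 /eqP q_i0 | no_i] := pickP (fun i : 'I_m => q i == b); last first.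
  by rewrite big_pred0 // add0r leNgt sum_deficits_lt1.
case: (@arg_minnP _ i0 (fun i => q i == b) val) => [|i /eqP q_i min_i]; first exact/eqP.
have open_i : opens q i.
  apply/negP; case/mapP=> j; rewrite mem_iota /= add0n => lt_ji q_j.
  have := min_i (Ordinal (ltn_trans lt_ji (ltn_ord i))); rewrite /= -q_j q_i eqxx.
  by move/(_ isT); rewrite leqNgt lt_ji.
rewrite (bigD1 i) ?q_i //= => le1; rewrite (bigD1 i) ?q_i //= open_i {1}/cover_weight.
case: ifP => [_|/negbT small_i]; first exact: leq_addr.
have [j /andP[/eqP q_j ne_ji] | no_j] := pickP (fun j : 'I_m => (q j == b) && (j != i)).
  rewrite (bigD1 j) ?q_j ?eqxx //= {1}/cover_weight /opens.
  suff -> : q j \in mkseq q j by [].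
  rewrite q_j -q_i map_f // mem_iota /= add0n ltn_neqAle eq_sym ne_ji.
  by apply: min_i; rewrite q_j.
move: le1; rewrite big_pred0 // addr0 => le1; have := sum_deficits_lt_small R (ltn_ord i) small_i.
by rewrite -/D => ltD; move: le1; rewrite leNgt; case/negP; lra.
Qed.

(** Double counting: each item lies in one bin, so its weight is charged at most once. *)
Lemma hard_input_covered :
  (3 * covered (fun i : 'I_(size (hard_input R m t)) => q i)
     <= \sum_(i < m) cover_weight (opens q i) (nth false t i))%N.
Proof.
set p := fun i => _; rewrite /covered -sum1_count big_distrr /= muln1.
apply: (@leq_trans (\sum_(b <- undup (codom p) | (1 <= level p b)%R)
    \sum_(i < m | q i == b) cover_weight (opens q i) (nth false t i))%N).
  exact/leq_sum/covered_bin_weight.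
rewrite (exchange_big_dep xpredT) //=; apply: leq_sum => i _.
rewrite (eq_bigl (fun b => (b == q i) && (1 <= level p b))); last first.
  by move=> b; rewrite andbC eq_sym.
apply: (@leq_trans (\sum_(b <- undup (codom p) | b == q i)
    cover_weight (opens q i) (nth false t i))); last first.
  rewrite big_const_seq iter_addn_0 -[leqRHS]muln1 leq_mul2l.
  by rewrite (count_uniq_mem _ (undup_uniq _)) leq_b1 orbT.
by rewrite [leqRHS](bigID (fun b => 1 <= level p b)) leq_addr.
Qed.

End CoveredUpperBound.

(** * Bets on unpredictable types *)

Lemma sum_prod_predictor (F : numDomainType) (g : bool -> bool -> F) (r : F)
    (m : nat) (f : seq bool -> bool) :
  (forall o l, 0 <= g o l) -> (forall o, g o true + g o false <= r) ->
  \sum_(t : m.-tuple bool) \prod_(i < m) g (f (take i t)) (nth false t i)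
    <= r ^+ m.
Proof.
move=> g_ge0 g_le; have r_ge0 : 0 <= r.
  by apply: le_trans (g_le true); rewrite addr_ge0.
elim: m f => [|m IHm] f.
  rewrite expr0 (eq_bigr (fun=> 1)) => [|t _]; last by rewrite big_ord0.
  by rewrite sumr_const card_tuple expn0.
pose h (p : bool * m.-tuple bool) := cons_tuple p.1 p.2.
have h_bij : bijective h.
  exists (fun t => (thead t, behead_tuple t)) => [[b t]|t]; last first.
    by rewrite [RHS]tuple_eta; apply: val_inj.
  by rewrite /h theadE; congr (_, _); apply: val_inj.
rewrite (reindex h) /=; last exact: onW_bij.
rewrite -(pair_bigA _ (fun b t => \prod_(i < m.+1)
  g (f (take i (cons_tuple b t))) (nth false (cons_tuple b t) i))) /=.
(* Once the first type [b] is fixed, [f (b :: s)] is a predictor for the rest; [f [::]] does not see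
   [b], so [g_le] applies to the sum over [b]. *)
have cons_sum b : \sum_(t : m.-tuple bool) \prod_(i < m.+1)
    g (f (take i (cons_tuple b t))) (nth false (cons_tuple b t) i)
    <= g (f [::]) b * r ^+ m.
  rewrite (eq_bigr (fun t : m.-tuple bool => g (f [::]) b * \prod_(i < m)
    g (f (b :: take i t)) (nth false t i))) => [|t _]; last by rewrite big_ord_recl.
  by rewrite -mulr_sumr ler_wpM2l // (IHm (fun s => f (b :: s))).
rewrite big_bool /= exprS; apply: le_trans (lerD (cons_sum true) (cons_sum false)) _.
by rewrite -mulrDl ler_wpM2r ?exprn_ge0.
Qed.

(** * Union bound over tape prefixes *)

Section Tapes.
Variables (R : realType) (A : advice_algorithm R).
Implicit Types (m s : nat) (Phi : tape).

(* Any base slightly above 1 makes both sums of bets in bet_sum_le less than 2. *)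
Definition tilt : R := 26 / 25.

(* The exponent 5 cover_weight - 7 OPT_weight is the contribution of an item to
   15 covered - 14 OPT. *)
Definition bet (o l : bool) : R :=
  tilt ^+ (5 * cover_weight o l) / tilt ^+ (7 * OPT_weight l).

Let tilt_gt0 : 0 < tilt. Proof. by rewrite divr_gt0 ?ltr0n. Qed.

Lemma bet_gt0 o l : 0 < bet o l.
Proof. by rewrite divr_gt0 ?exprn_gt0. Qed.

(** The exponents of [tilt] are 1 and -2 for an opener, -4 and 3 otherwise. Both pairs have negative
    sum, so a base slightly above 1 pushes the bets below 2. *)
Lemma bet_sum_le o : bet o true + bet o false <= 2 * (99 / 100).
Proof. by case: o; rewrite /bet /tilt /=; lra. Qed.

Definition item_bin Phi m t j := bin_of A Phi (take j.+1 (hard_input R m t)).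

Lemma sum_bets_le Phi m :
  \sum_(t : m.-tuple bool)
     \prod_(i < m) bet (opens (item_bin Phi m t) i) (nth false t i)
  <= (2 * (99 / 100)) ^+ m.
Proof.
pose items p j := mkseq (fun k => 1 - deficit R m p k) j.
(* For a fixed tape, [f] replays the algorithm from the types in [p], which determine all sizes up
   to that of item [size p]. *)
pose f p := opens (fun j => bin_of A Phi (items p j.+1)) (size p).
apply: (le_trans _ (sum_prod_predictor m f (fun o l => ltW (bet_gt0 o l)) bet_sum_le)).
apply: ler_sum => t _; rewrite le_eqVlt; apply/predU1P; left.
apply: eq_bigr => i _; congr (bet _ _).
have bin_take j : (j <= i)%N ->
    item_bin Phi m t j = bin_of A Phi (items (take i t) j.+1).
  move=> le_ji; rewrite /item_bin take_hard_input; last first.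
    exact: leq_ltn_trans le_ji (ltn_ord i).
  congr (bin_of _ _ _); apply/eq_in_map => k; rewrite mem_iota add0n ltnS => le_kj.
  by rewrite /deficit exponent_take // (leq_trans le_kj).
rewrite /f size_takel ?size_tuple ?(ltnW (ltn_ord i)) // /opens bin_take //.
congr (_ \notin _); apply/eq_in_map => j; rewrite mem_iota add0n => lt_ji.
by rewrite bin_take // ltnW.
Qed.

Lemma prod_bets_ge Phi m t (b : R) (K : nat) : 15 * b + 7 <= K%:R ->
  15 / 16 * (OPT (hard_input R m t))%:R - b <= (bins_covered A Phi (hard_input R m t))%:R ->
  tilt ^- K <= \prod_(i < m) bet (opens (item_bin Phi m t) i) (nth false t i).
Proof.
move=> b_le cov_ge; rewrite prodf_div !prodrXr -!big_distrr /=.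
set u := (\sum_(i < m) cover_weight _ _)%N; set v := (\sum_(i < m) OPT_weight _)%N.
(* As 15/16 exceeds 14/15, the hypothesis gives 15 covered >= 14 OPT - 15 b; the 7 in [K] absorbs
   the rounding in [hard_input_OPT]. *)
have le_vu : (7 * v <= K + 5 * u)%N.
  have := hard_input_covered R m t (item_bin Phi m t); rewrite -/u.
  have := hard_input_OPT R m t; rewrite -/v.
  rewrite -/(bins_covered A Phi (hard_input R m t)).
  rewrite -!(ler_nat R) -addn1 -muln2 !natrD !natrM.
  have : 0 <= (OPT (hard_input R m t))%:R :> R by rewrite ler0n.
  lra.
rewrite ler_pdivlMr ?exprn_gt0 // mulrC ler_pdivrMr ?exprn_gt0 // -exprD.
by apply: ler_weXn2l; [rewrite /tilt; lra | lia].
Qed.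

(** No decision reads beyond cell [k], so the tape can be cut after [s] cells and continued by
    [false]. *)
Lemma finite_tape Phi (sigma : seq R) k s :
  bits_read A Phi sigma = Some k -> (k <= s)%N ->
  exists u : s.-tuple bool,
    bins_covered A (nth false u) sigma = bins_covered A Phi sigma.
Proof.
move=> read_k le_ks; exists [tuple Phi i | i < s].
apply: eq_covered => i /=; have [j read_j le_jk] := bits_read_prefix i.+1 read_k.
apply: (bits_read_local read_j _).2 => l lt_lj.
have lt_ls : (l < s)%N by lia.
exact: (nth_mktuple (fun i : 'I_s => Phi i) false (Ordinal lt_ls)).
Qed.

Lemma advice_lower_bound (b : R) (K m s : nat) : 15 * b + 7 <= K%:R ->
  (forall t : m.-tuple bool, exists Phi : tape,
    15 / 16 * (OPT (hard_input R m t))%:R - b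
      <= (bins_covered A Phi (hard_input R m t))%:R /\
    exists2 k, bits_read A Phi (hard_input R m t) = Some k & (k <= s)%N) ->
  (m %/ 100 <= s + K)%N.
Proof.
move=> b_le good.
pose P (u : s.-tuple bool) (t : m.-tuple bool) :=
  \prod_(i < m) bet (opens (item_bin (nth false u) m t) i) (nth false t i).
have P_ge0 u t : 0 <= P u t by apply: prodr_ge0 => i _; apply/ltW/bet_gt0.
have le_sum (t : m.-tuple bool) : tilt ^- K <= \sum_(u : s.-tuple bool) P u t.
  have [Phi [cov_ge [k read_k le_ks]]] := good t.
  have [u eq_u] := finite_tape read_k le_ks; rewrite -eq_u in cov_ge.
  rewrite (bigD1 u) //= -[leLHS]addr0 lerD ?(prod_bets_ge b_le) //.
  by rewrite sumr_ge0.
(* For every [t] some prefix [u] wins at least [tilt ^- K]; the double sum over [t] and [u] is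
   bounded from both sides. *)
have : 2 ^+ m * tilt ^- K <= 2 ^+ s * (2 * (99 / 100)) ^+ m.
  apply: (@le_trans _ _ (\sum_(t : m.-tuple bool) \sum_(u : s.-tuple bool) P u t)).
    apply: (le_trans _ (ler_sum _ (fun t _ => le_sum t))).
    by rewrite sumr_const card_tuple card_bool -[leRHS]mulr_natl natrX.
  rewrite exchange_big /=; apply: le_trans (ler_sum _ (fun u _ => sum_bets_le _ m)) _.
  by rewrite sumr_const card_tuple card_bool -[leLHS]mulr_natl natrX.
have tiltK : tilt ^- K >= 2 ^- K :> R.
  by rewrite lef_pV2 ?posrE ?exprn_gt0 // lerXn2r ?nnegrE ?ltW //; rewrite /tilt; lra.
rewrite [in leRHS]exprMn [leRHS]mulrCA ler_pM2l ?exprn_gt0 // => le_tilt.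
have {tiltK le_tilt} : 2 ^- K <= 2 ^+ s * (99 / 100) ^+ m :> R := le_trans tiltK le_tilt.
rewrite -[(99 / 100)]invrK exprVn ler_pdivlMr ?exprn_gt0 ?invr_gt0 ?divr_gt0 //.
rewrite mulrC ler_pdivrMr ?exprn_gt0 // -exprD => le_s.
rewrite -(@ler_eXn2l R 2) ?ltr1n //; apply: le_trans le_s.
(* Factors are grouped in blocks of 100, since (100/99)^100 >= 2. *)
apply: (@le_trans _ _ ((99 / 100)^-1 ^+ (100 * (m %/ 100)))); last first.
  by rewrite ler_weXn2l 1?mulnC ?leq_trunc_div // -[leLHS]invr1 lef_pV2 ?posrE; lra.
rewrite exprM lerXn2r ?nnegrE ?exprn_ge0 ?invr_ge0 //; lra.
Qed.

End Tapes.

Theorem theorem4 (R : realType) (delta : R) (hdelta : 0 < delta) :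
  exists2 c : R, 0 < c &
    forall (A : advice_algorithm R) (s : nat -> nat),
      competitive_with_advice A (15%:R / 16%:R + delta) s ->
      exists N : nat, forall n : nat, (N <= n)%N -> c * n%:R <= (s n)%:R.
Proof.
exists (1 / 400); first by lra.
move=> A s [b competitive].
have [K b_le] : exists K : nat, 15 * b + 7 <= K%:R.
  exists (Num.bound `|15 * b + 7|).
  by apply: le_trans (ler_norm _) _; apply/ltW/archi_boundP.
(* With n/2 first-phase items the bound is about n/200 - K; from this threshold on, n/400 absorbs
   [K] and the rounding. *)
exists (400 * K.+1)%N => n le_n.
suff : (n <= 400 * s n)%N by rewrite -(ler_nat R) natrM; lra.
suff : (n./2 %/ 100 <= s n + K)%N by have := odd_double_half n; lia.
apply: (@advice_lower_bound _ A _ _ _ _ b_le) => t.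
have [|Phi [cov_ge reads]] := competitive n (hard_input R n./2 t) (hard_input_valid R _ _).
  by apply: leq_trans (size_hard_input R _ _) _; have := odd_double_half n; lia.
exists Phi; split => //; apply: le_trans cov_ge.
by rewrite lerD2r ler_wpM2r ?ler0n // lerDl ltW.
Qed.
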